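(* Let $k$ be a $2$-bridge knot, and let $\gamma_\phi$ be a total representation associated to a nonabelian parabolic representation $\gamma:\pi\to\mathrm{SL}_2\mathbb C$ of the group $\pi$ of $k$. Then $|\Delta_{k,\gamma_\phi}(1)|=2^{\deg\phi}$.
   Context: The group of a $2$-bridge knot $k$ has a presentation $\pi=\langle x,y\mid Wx=yW\rangle$ with $x,y$ meridians and $W$ a word in $x^{\pm1},y^{\pm1}$. A representation $\gamma:\pi\to\mathrm{SL}_2\mathbb C$ is parabolic if the image of any meridian has trace $2$. Any nonabelian parabolic representation is (Riley) conjugate to one with $x\mapsto\begin{pmatrix}1&1\\0&1\end{pmatrix}$, $y\mapsto\begin{pmatrix}1&0\\ w&1\end{pmatrix}$, $0\neq w\in\mathbb C$, where $w$ is a zero of the Riley polynomial $\Phi(w)$, a monic integer polynomial given by the $(1,1)$-entry of $\gamma(W)$; $w$ is an algebraic unit. Let $\phi$ be the irreducible factor of $\Phi$ that is the (monic) minimal polynomial of $w$, and $C$ its companion matrix. The total representation $\gamma_\phi:\pi\to\mathrm{GL}_N\mathbb Z$, $N=2\deg\phi$, is $x\mapsto\begin{pmatrix}I&I\\0&I\end{pmatrix}$, $y\mapsto\begin{pmatrix}I&0\\C&I\end{pmatrix}$ (blocks of size $\deg\phi$). The total $\gamma_\phi$-twisted Alexander polynomial $\Delta_{k,\gamma_\phi}$ is defined as follows. $V=\mathbb Z^N$ (row vectors) is a right $\mathbb Z[\pi]$-module via $\gamma_\phi$; $X$ is the knot exterior, $\tilde X$, $X'$ its universal and infinite cyclic covers,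 $\epsilon:\pi\to\langle t\rangle\cong\mathbb Z$ abelianization; $H_*(X';V)$ is the homology of $(\mathbb Z[t^{\pm1}]\otimes V)\otimes_{\mathbb Z[\pi]}C_*(\tilde X)$ with $(p\otimes v)\cdot g=pt^{\epsilon(g)}\otimes v\gamma_\phi(g)$. Then $\Delta_{k,\gamma_\phi}$ is the greatest common divisor of the maximal minors of a presentation matrix of the $\mathbb Z[t^{\pm1}]$-module $H_1(X';V)$, well defined up to multiplication by $\pm t^i$. *)

(* Defs.v *)
From HB Require Import structures.
From mathcomp Require Import all_boot all_order all_algebra.
From mathcomp Require Import generic_quotient ring_quotient fraction complex.
From mathcomp Require Import boolp classical_sets reals.

Set Implicit Arguments.
Unset Strict Implicit.
Unset Printing Implicit Defensive.

Import GRing.Theory.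
Local Open Scope ring_scope.
Local Open Scope quotient_scope.

Definition gen := bool.
Definition gx : gen := false.
Definition gy : gen := true.

(** [(g, true)] stands for g and [(g, false)] for g^-1. *)
Definition letter := (gen * bool)%type.
Definition word := seq letter.

Definition inv_letter (l : letter) : letter := (l.1, ~~ l.2).
Definition inv_word (u : word) : word := rev (map inv_letter u).

Section OneRelatorGroup.
Variable r : word.

Inductive word_equiv : word -> word -> Prop :=
| weq_refl u : word_equiv u u
| weq_sym u v : word_equiv u v -> word_equiv v u
| weq_trans u v w : word_equiv u v -> word_equiv v w -> word_equiv u w
| weq_cancel u l v : word_equiv (u ++ l :: inv_letter l :: v) (u ++ v)
| weq_relator u v : word_equiv (u ++ r ++ v) (u ++ v).

Definition word_equivb (u v : word) : bool := `[< word_equiv u v >].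

Lemma word_equivb_equiv : equiv_class_of word_equivb.
Proof.
split=> [u|u v|v u w].
- exact/asboolP/weq_refl.
- by apply/asboolP/asboolP; apply: weq_sym.
- by move=> /asboolP uv /asboolP vw; apply/asboolP/(weq_trans uv vw).
Qed.

Canonical word_equiv_equiv := EquivRelPack word_equivb_equiv.
Canonical word_equiv_encModRel := defaultEncModRel word_equivb.

Definition one_relator_group := {eq_quot word_equivb}.

HB.instance Definition _ : EqQuotient word word_equivb one_relator_group :=
  EqQuotient.on one_relator_group.
HB.instance Definition _ := Choice.on one_relator_group.

Definition word_class (u : word) : one_relator_group := \pi u.

Lemma word_classP u v : word_class u = word_class v <-> word_equiv u v.
Proof.
split=> [/eqP|uv].
  by rewrite /word_class piE => /asboolP.
by apply/eqP; rewrite /word_class piE; apply/asboolP.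
Qed.

Lemma word_equiv_catl w u v : word_equiv u v -> word_equiv (w ++ u) (w ++ v).
Proof.
elim=> {u v} [u|u v _|u v t _ uv _|u l v|u v]; rewrite ?catA.
- exact: weq_refl.
- exact: weq_sym.
- exact: weq_trans.
- exact: weq_cancel.
- rewrite -catA; exact: weq_relator.
Qed.

Lemma word_equiv_catr w u v : word_equiv u v -> word_equiv (u ++ w) (v ++ w).
Proof.
elim=> {u v} [u|u v _|u v t _ uv _|u l v|u v]; rewrite -?catA /=.
- exact: weq_refl.
- exact: weq_sym.
- exact: weq_trans.
- exact: weq_cancel.
- exact: weq_relator.
Qed.

Lemma word_equiv_cat u u' v v' :
  word_equiv u u' -> word_equiv v v' -> word_equiv (u ++ v) (u' ++ v').
Proof.
move=> uu' vv'; apply: weq_trans (word_equiv_catr _ uu') _.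
exact: word_equiv_catl.
Qed.

Lemma inv_letterK : involutive inv_letter.
Proof. by case=> g b; rewrite /inv_letter /= negbK. Qed.

Lemma inv_wordK : involutive inv_word.
Proof.
by move=> u; rewrite /inv_word map_rev revK -map_comp map_id_in // => l _ /=;
  rewrite inv_letterK.
Qed.

Lemma inv_word_cat u v : inv_word (u ++ v) = inv_word v ++ inv_word u.
Proof. by rewrite /inv_word map_cat rev_cat. Qed.

Lemma word_equiv_mulV u : word_equiv (u ++ inv_word u) [::].
Proof.
elim: u => [|l u IHu]; first exact: weq_refl.
rewrite -cat1s inv_word_cat -catA (catA u).
apply: weq_trans (word_equiv_catl _ (word_equiv_catr _ IHu)) _.
exact: (weq_cancel [::] l [::]).
Qed.

Lemma word_equiv_Vmul u : word_equiv (inv_word u ++ u) [::].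
Proof. by rewrite -{2}[u]inv_wordK; apply: word_equiv_mulV. Qed.

Lemma word_equiv_inv u v : word_equiv u v -> word_equiv (inv_word u) (inv_word v).
Proof.
move=> uv.
have h : word_equiv (inv_word u ++ v ++ inv_word v) (inv_word u).
  by rewrite -{2}[inv_word u]cats0; apply/word_equiv_catl/word_equiv_mulV.
apply: weq_trans (weq_sym h) _; rewrite catA -[X in word_equiv _ X]cat0s.
apply: word_equiv_catr; apply: weq_trans (word_equiv_Vmul u).
exact/word_equiv_catl/weq_sym.
Qed.

Definition group_one : one_relator_group := word_class [::].
Definition group_mul (a b : one_relator_group) : one_relator_group :=
  word_class (repr a ++ repr b).
Definition group_inv (a : one_relator_group) : one_relator_group :=
  word_class (inv_word (repr a)).

Lemma word_equiv_repr u : word_equiv (repr (word_class u)) u.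
Proof. by apply/word_classP; rewrite /word_class reprK. Qed.

Lemma word_class_repr a : word_class (repr a) = a.
Proof. exact: reprK. Qed.

Lemma group_mulE u v : group_mul (word_class u) (word_class v) = word_class (u ++ v).
Proof. by apply/word_classP/word_equiv_cat; apply: word_equiv_repr. Qed.

Lemma group_invE u : group_inv (word_class u) = word_class (inv_word u).
Proof. by apply/word_classP/word_equiv_inv/word_equiv_repr. Qed.

Lemma group_mulA : associative group_mul.
Proof.
move=> a b c; rewrite -[a]word_class_repr -[b]word_class_repr -[c]word_class_repr.
by rewrite !group_mulE catA.
Qed.

Lemma group_mul1 : left_id group_one group_mul.
Proof. by move=> a; rewrite -[a]word_class_repr group_mulE. Qed.

Lemma group_1mul : right_id group_one group_mul.
Proof. by move=> a; rewrite -[a]word_class_repr group_mulE cats0. Qed.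

Lemma group_mulV : left_inverse group_one group_inv group_mul.
Proof.
move=> a; rewrite -[a]word_class_repr group_invE group_mulE.
exact/word_classP/word_equiv_Vmul.
Qed.

Lemma group_Vmul : right_inverse group_one group_inv group_mul.
Proof.
move=> a; rewrite -[a]word_class_repr group_invE group_mulE.
exact/word_classP/word_equiv_mulV.
Qed.

HB.instance Definition _ := isGroup.Build one_relator_group
  group_mulA group_mul1 group_1mul group_mulV group_Vmul.

End OneRelatorGroup.

(** Schubert normal form: every 2-bridge knot is S(alpha, beta) for such
    alpha, beta.  Negative beta are the mirror images. *)
Record two_bridge_knot := TwoBridgeKnot {
  alpha : nat;
  beta : int;
  alpha_gt1 : (1 < alpha)%N;
  alpha_odd : odd alpha;
  beta_odd : odd `|beta|%N;
  beta_lt : (`|beta| < alpha)%N;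
  alpha_beta_coprime : coprime alpha `|beta|%N
}.

(** W = x^e_1 y^e_2 x^e_3 ... y^e_(alpha-1), e_i = (-1)^floor(i beta / alpha). *)
Definition bridge_word (k : two_bridge_knot) : word :=
  [seq (if odd i then gx else gy,
        ~~ odd `|(i%:Z * beta k %/ (alpha k)%:Z)%Z|%N)
     | i <- iota 1 (alpha k).-1].

(** W x W^-1 y^-1, i.e. the relation W x = y W. *)
Definition bridge_relator (k : two_bridge_knot) : word :=
  bridge_word k ++ [:: (gx, true)] ++ inv_word (bridge_word k)
    ++ [:: (gy, false)].

Definition knot_group (k : two_bridge_knot) :=
  one_relator_group (bridge_relator k).
HB.instance Definition _ k := Group.on (knot_group k).

Definition in_group (k : two_bridge_knot) (u : word) : knot_group k :=
  word_class (bridge_relator k) u.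

Definition knot_gen (k : two_bridge_knot) (g : gen) : knot_group k :=
  in_group k [:: (g, true)].

(** The knot being connected, its meridians (of either orientation) are the
    conjugates of x and of x^-1. *)
Definition is_meridian (k : two_bridge_knot) (m : knot_group k) : Prop :=
  exists g : knot_group k,
    m = (knot_gen k gx ^ g)%g \/ m = ((knot_gen k gx)^-1 ^ g)%g.

Definition exponent_sum (u : word) : int :=
  \sum_(l <- u) (if l.2 then 1 else -1).

(** Well defined on classes: see [abelianization_word]. *)
Definition abelianization (k : two_bridge_knot) (g : knot_group k) : int :=
  exponent_sum (repr g).

Lemma exponent_sum_cat u v :
  exponent_sum (u ++ v) = exponent_sum u + exponent_sum v.
Proof. exact: big_cat. Qed.

Lemma exponent_sum_inv u : exponent_sum (inv_word u) = - exponent_sum u.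
Proof.
elim: u => [|l u IHu]; first by rewrite /exponent_sum !big_nil oppr0.
rewrite -cat1s inv_word_cat !exponent_sum_cat IHu opprD addrC; congr (_ + _).
by rewrite /exponent_sum !big_seq1 /=; case: l.2; rewrite ?opprK.
Qed.

Lemma exponent_sum_relator k : exponent_sum (bridge_relator k) = 0.
Proof.
rewrite !exponent_sum_cat exponent_sum_inv /exponent_sum !big_seq1 /=.
by rewrite addrCA addNKr subrr.
Qed.

Lemma exponent_sum_equiv k u v :
  word_equiv (bridge_relator k) u v -> exponent_sum u = exponent_sum v.
Proof.
elim=> {u v} [//|//|u v w _ -> _ -> //|u l v|u v].
  rewrite -[l :: _]/([:: l; inv_letter l] ++ v) !exponent_sum_cat.
  congr (_ + _); rewrite -[RHS]add0r; congr (_ + _).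
  by rewrite /exponent_sum big_cons big_seq1 /=; case: l.2.
rewrite (exponent_sum_cat u) (exponent_sum_cat (bridge_relator k)).
by rewrite exponent_sum_relator add0r exponent_sum_cat.
Qed.

Lemma abelianization_word k u : abelianization (in_group k u) = exponent_sum u.
Proof. exact/exponent_sum_equiv/word_equiv_repr. Qed.

Lemma abelianizationM k (g h : knot_group k) :
  abelianization (g * h)%g = abelianization g + abelianization h.
Proof. by rewrite [LHS]abelianization_word exponent_sum_cat. Qed.

Definition is_representation (G : groupType) (R : comUnitRingType) (n : nat)
    (rho : G -> 'M[R]_n) : Prop :=
  rho 1%g = 1%:M /\ forall g h, rho (g * h)%g = rho g *m rho h.

Definition is_SL_representation (G : groupType) (R : comUnitRingType) (n : nat)
    (rho : G -> 'M[R]_n) : Prop :=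
  is_representation rho /\ forall g, \det (rho g) = 1.

Definition is_parabolic (k : two_bridge_knot) (F : fieldType)
    (gamma : knot_group k -> 'M[F]_2) : Prop :=
  forall m, is_meridian m -> \tr (gamma m) = 2.

Definition is_nonabelian (G : groupType) (R : comUnitRingType) (n : nat)
    (rho : G -> 'M[R]_n) : Prop :=
  exists g h, rho g *m rho h != rho h *m rho g.

Definition riley_matrix (R : pzRingType) (n : nat) (C : 'M[R]_n) (g : gen) :
    'M[R]_(n + n) :=
  if g == gx then block_mx 1%:M 1%:M 0 1%:M else block_mx 1%:M 0 C 1%:M.

Definition riley_conjugate (k : two_bridge_knot) (F : fieldType)
    (gamma : knot_group k -> 'M[F]_2) (w : F) : Prop :=
  w != 0 /\
  exists2 P : 'M[F]_2, P \in unitmx &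
    forall g, P *m gamma (knot_gen k g) *m invmx P = riley_matrix (w%:M : 'M_1) g.

Definition letter_eval (R : comUnitRingType) (n : nat) (A : gen -> 'M[R]_n)
    (l : letter) : 'M[R]_n :=
  if l.2 then A l.1 else invmx (A l.1).

Definition word_eval (R : comUnitRingType) (n : nat) (A : gen -> 'M[R]_n)
    (u : word) : 'M[R]_n :=
  foldr (fun l M => letter_eval A l *m M) 1%:M u.

(** The indeterminate 'X plays the role of w. *)
Definition riley_poly (k : two_bridge_knot) : {poly int} :=
  word_eval (riley_matrix ('X%:M : 'M[{poly int}]_1)) (bridge_word k) ord0 ord0.

(** A monic integer polynomial irreducible over Q and vanishing at w is the
    minimal polynomial of w. *)
Definition riley_factor (k : two_bridge_knot) (F : fieldType) (w : F)
    (phi : {poly int}) : Prop :=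
  [/\ phi \is monic,
      irreducible_poly (map_poly intr phi : {poly rat}),
      root (map_poly intr phi) w &
      exists psi, riley_poly k = psi * phi].

Definition is_total_representation (k : two_bridge_knot) (phi : {poly int})
    (rho : knot_group k -> 'M[int]_((size phi).-1 + (size phi).-1)) : Prop :=
  is_representation rho /\
  forall g, rho (knot_gen k g) = riley_matrix (companionmx phi) g.

Local Notation Zt := {fraction {poly int}}.
Local Notation frac := (@tofrac {poly int}).

(** Z[t, t^-1] is realized as a subring of Frac Z[t] = Q(t). *)
Definition is_laurent (f : Zt) : bool :=
  `[< exists n (p : {poly int}), f = frac p / frac 'X ^+ n >].

Lemma fracX_unit n : frac 'X ^+ n != 0.
Proof. by rewrite expf_neq0 // tofrac_eq0 polyX_eq0. Qed.

Lemma is_laurent_subring : subring_closed is_laurent.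
Proof.
split.
- by apply/asboolP; exists 0, 1; rewrite tofrac1 expr0 divr1.
- move=> f g /asboolP[m [p ->]] /asboolP[n [q ->]]; apply/asboolP.
  exists (m + n)%N, (p * 'X^n - q * 'X^m); rewrite tofracB !tofracM !tofracXn exprD.
  rewrite mulrBl -mulf_div divff ?fracX_unit // mulr1 [_ ^+ m * _]mulrC.
  by rewrite -mulf_div divff ?fracX_unit // mulr1.
- move=> f g /asboolP[m [p ->]] /asboolP[n [q ->]]; apply/asboolP.
  by exists (m + n)%N, (p * q); rewrite tofracM exprD mulf_div.
Qed.

HB.instance Definition _ :=
  GRing.isSubringClosed.Build Zt is_laurent is_laurent_subring.

Record laurent := Laurent { laurent_val :> Zt; laurentP : is_laurent laurent_val }.
HB.instance Definition _ := [isSub for laurent_val].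
HB.instance Definition _ := [Choice of laurent by <:].
HB.instance Definition _ := [SubChoice_isSubComNzRing of laurent by <:].

Lemma laurent_t_subproof (z : int) : is_laurent (frac 'X ^ z).
Proof.
apply/asboolP; case: z => n.
  by exists 0, 'X^n; rewrite tofracXn expr0 divr1.
by exists n.+1, 1; rewrite tofrac1 div1r NegzE -exprnN.
Qed.

Definition laurent_t (z : int) : laurent := Laurent (laurent_t_subproof z).

(** f(1) = p(1) for any writing f = p / t^n: see [laurent_at1E]. *)
Definition laurent_at1 (f : laurent) : int :=
  let: exist _ fE := cid (asboolW (laurentP f)) in (projT1 (cid fE)).[1].

Lemma laurent_at1E (f : laurent) n p :
  val f = frac p / frac 'X ^+ n -> laurent_at1 f = p.[1].
Proof.
rewrite /laurent_at1; case: cid => m fE; case: cid => q /= -> /eqP.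
rewrite eqr_div ?fracX_unit // -!tofracXn -!tofracM tofrac_eq => /eqP /(congr1 (horner^~ 1)).
by rewrite !hornerE !expr1n !mulr1.
Qed.

(** Homology ker d1 / im d2 at R^b of a chain complex
    R^a --d2--> R^b --d1--> R^c; matrices act on row vectors. *)
Section Homology.
Variables (R : comNzRingType) (a b c : nat).
Variables (d2 : 'M[R]_(a, b)) (d1 : 'M[R]_(b, c)).

Definition is_cycle (v : 'rV[R]_b) : bool := v *m d1 == 0.

Lemma is_cycle_submod : submod_closed is_cycle.
Proof.
split=> [|r u v]; rewrite !unfold_in; first by rewrite mul0mx.
by move=> /eqP u0 /eqP v0; rewrite mulmxDl -scalemxAl u0 v0 scaler0 addr0.
Qed.

HB.instance Definition _ :=
  GRing.isSubmodClosed.Build R 'rV[R]_b is_cycle is_cycle_submod.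

Record cycle := Cycle { cycle_val :> 'rV[R]_b; cycleP : is_cycle cycle_val }.
HB.instance Definition _ := [isSub for cycle_val].
HB.instance Definition _ := [Choice of cycle by <:].
HB.instance Definition _ := [SubChoice_isSubLmodule of cycle by <:].

Definition is_boundary (z : cycle) : bool :=
  `[< exists u : 'rV[R]_a, val z = u *m d2 >].

Lemma is_boundary_submod : submod_closed is_boundary.
Proof.
split=> [|r y z /asboolP[u uE] /asboolP[v vE]]; apply/asboolP.
  by exists 0; rewrite mul0mx.
by exists (r *: u + v); rewrite mulmxDl -scalemxAl -uE -vE.
Qed.

HB.instance Definition _ :=
  GRing.isSubmodClosed.Build R cycle is_boundary is_boundary_submod.

Definition homology := Quotient.quot (GRing.ZmodClosed.clone cycle is_boundary _).
HB.instance Definition _ := GRing.Zmodule.on homology.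

Definition homology_class (z : cycle) : homology := \pi z.

Definition homology_scale (r : R) (h : homology) : homology :=
  homology_class (r *: repr h).

Lemma homology_classP y z :
  homology_class y = homology_class z <-> is_boundary (y - z).
Proof.
rewrite /homology_class; split=> [/eqP|yz].
  by rewrite -Quotient.idealrBE.
by apply/eqP; rewrite -Quotient.idealrBE.
Qed.

Lemma homology_classD y z :
  homology_class (y + z) = homology_class y + homology_class z.
Proof. exact: Quotient.pi_add. Qed.

Lemma homology_class_repr h : homology_class (repr h) = h.
Proof. exact: reprK. Qed.

Lemma homology_classZ r z :
  homology_class (r *: z) = homology_scale r (homology_class z).
Proof.
apply/homology_classP; rewrite -scalerBr.
have /homology_classP/asboolP[u uE] :
    homology_class z = homology_class (repr (homology_class z)) by rewrite homology_class_repr.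
by apply/asboolP; exists (r *: u); rewrite -scalemxAl -uE.
Qed.

Lemma homology_scaleA r s h :
  homology_scale r (homology_scale s h) = homology_scale (r * s) h.
Proof. by rewrite -[h]homology_class_repr -!homology_classZ scalerA. Qed.

Lemma homology_scale1 : left_id 1 homology_scale.
Proof. by move=> h; rewrite -[h]homology_class_repr -homology_classZ scale1r. Qed.

Lemma homology_scaleDr : right_distributive homology_scale +%R.
Proof.
move=> r h k; rewrite -[h]homology_class_repr -[k]homology_class_repr.
by rewrite -homology_classD -!homology_classZ scalerDr homology_classD.
Qed.

Lemma homology_scaleDl h : {morph homology_scale^~ h : r s / r + s}.
Proof.
move=> r s; rewrite -[h]homology_class_repr -!homology_classZ.
by rewrite scalerDl homology_classD.
Qed.

HB.instance Definition _ := GRing.Zmodule_isLmodule.Build R homology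
  homology_scaleA homology_scale1 homology_scaleDr homology_scaleDl.

End Homology.

(** The rows of A are relations among the n generators: M = R^n / R^m A. *)
Definition is_presentation_matrix (R : comNzRingType) (M : lmodType R)
    (m n : nat) (A : 'M[R]_(m, n)) : Prop :=
  exists f : {linear 'rV[R]_n -> M},
    (forall h, exists v, f v = h) /\
    (forall v, f v = 0 <-> exists u : 'rV[R]_m, v = u *m A).

Definition divides (R : comNzRingType) (d e : R) : Prop :=
  exists q, e = q * d.

Definition is_gcd (R : comNzRingType) (S : set R) (d : R) : Prop :=
  (forall s, S s -> divides d s) /\
  (forall e, (forall s, S s -> divides e s) -> divides e d).

(** The n x n minors, n being the number of generators; noninjective row
    selections only contribute 0. *)
Definition maximal_minors (R : comNzRingType) (m n : nat) (A : 'M[R]_(m, n)) :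
    set R :=
  [set d | exists f : 'I_n -> 'I_m, d = \det (rowsub f A)].

Definition is_order (R : comNzRingType) (M : lmodType R) (d : R) : Prop :=
  exists m n (A : 'M[R]_(m, n)),
    is_presentation_matrix M A /\ is_gcd (maximal_minors A) d.

Section TwistedHomology.
Variables (k : two_bridge_knot) (N : nat) (rho : knot_group k -> 'M[int]_N).

(** The right action of g on Z[t, t^-1] (x) Z^N = Z[t, t^-1]^N. *)
Definition twisted_action (g : knot_group k) : 'M[laurent]_N :=
  laurent_t (abelianization g) *: map_mx intr (rho g).

(** Fox derivative d u / d g, as a formal sum of signed words:
    d(uv) = du + u dv, d(g) = 1, d(g^-1) = - g^-1. *)
Fixpoint fox (g : gen) (u : word) : seq (int * word) :=
  if u is l :: u' then
    (if l.1 == g then [:: if l.2 then (1, [::]) else (-1, [:: l])] else [::])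
      ++ [seq (cv.1, l :: cv.2) | cv <- fox g u']
  else [::].

Definition fox_action (g : gen) (u : word) : 'M[laurent]_N :=
  \sum_(cv <- fox g u) cv.1%:~R *: twisted_action (in_group k cv.2).

(** The exterior X deformation retracts onto the 2-complex of the presentation
    <x, y | r>, r = W x W^-1 y^-1, with one vertex, two edges and one face.  In
    the cellular chain complex C_2 -> C_1 -> C_0 of the universal cover the lift
    of the face has boundary (dr/dx) x + (dr/dy) y and the lift of the edge g
    has boundary g - 1. *)
Definition boundary1 : 'M[laurent]_(N + N, N) :=
  col_mx (twisted_action (knot_gen k gx) - 1%:M)
         (twisted_action (knot_gen k gy) - 1%:M).

Definition boundary2 : 'M[laurent]_(N, N + N) :=
  row_mx (fox_action gx (bridge_relator k)) (fox_action gy (bridge_relator k)).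

Definition twisted_H1 := homology boundary2 boundary1.
HB.instance Definition _ := GRing.Lmodule.on twisted_H1.

(** Defined up to a unit +- t^i: an arbitrary representative is chosen. *)
Definition twisted_alexander : laurent :=
  xget 0 [set d | is_order twisted_H1 d].

End TwistedHomology.

(* Main.v *)
From HB Require Import structures.
Require Import Defs.
From mathcomp Require Import all_boot all_order all_algebra.
From mathcomp Require Import complex reals.
From mathcomp Require Import perm zify ring fraction boolp classical_sets.

(** Write x, y, W for the images of the generators and of [bridge_word] under the
    total representation, and d for the degree of phi.

    The matrix t x - t y is invertible over the Laurent ring, since x - y has
    blocks 0, 1, - C, 0 and C turns out to be unimodular.  A 1-cycle (u, v) is
    therefore determined by u + v, the module of cycles is free, and H_1 is
    presented by the square matrix r_x + r_y, the sum of the Fox derivatives of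
    the relator ([twisted_H1_presentation]).  By invariance of Fitting ideals
    ([order_square_presentation]) the Alexander polynomial is its determinant up
    to a unit, and evaluating at t = 1 leaves the integral matrix r_x + r_y to
    be studied.

    Comparing blocks in W x = y W gives W = [0 b; C b e].  The palindromic
    symmetry of the exponents says that the automorphism x |-> y^-1, y |-> x^-1
    sends W to W^-1; it is realized by conjugation by a matrix, which yields
    b C b = - 1 ([bCb]) and, by the chain rule, expresses the derivative of W
    in y by the derivative in x ([fox_bridge_word_y]).  One pivot then reduces
    the determinant of r_x + r_y to that of the d x d matrix
    E = e - C b - 2 C f, with f a block of the derivative of W in x
    ([fox_pivotE]).

    E is divisible by 2: modulo 2 the generators are involutions, so W is a
    power of x y, and commuting with x y forces e = C b
    ([act_bridge_word_mod2]).

    E divides 2: E presents H_1 at t = 1, which is generated by the classes of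
    the meridian x with coefficients fixed by x.  These classes come from the
    boundary torus.  The longitude W* W, where W* is W with x and y exchanged,
    acts on the coefficients fixed by x as - 1, so that the relation of the
    torus gives 2 times each class equal to 0 ([fox_pivot_dvd2]).  This needs
    the relation x W* = W* y in the knot group, a rotation of the relator which
    exists because beta is invertible modulo 2 alpha ([swap_relator_rot]).

    Hence E = 2 F with F unimodular, and the determinant is 2^d up to sign. *)

Import GRing.Theory Num.Theory.
Local Open Scope ring_scope.

Set Implicit Arguments.
Unset Strict Implicit.
Unset Printing Implicit Defensive.

(** * Modules with a square presentation *)

Lemma divides_mull (R : comNzRingType) (d x y : R) :
  divides d x -> divides d (y * x).
Proof. by case=> q ->; exists (y * q); rewrite mulrA. Qed.

Lemma divides_sum (R : comNzRingType) (I : finType) (d : R) (F : I -> R) :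
  (forall i, divides d (F i)) -> divides d (\sum_i F i).
Proof.
move=> dF; elim/big_ind: _ => // [|_ _ [a ->] [b ->]].
  by exists 0; rewrite mul0r.
by exists (a + b); rewrite mulrDl.
Qed.

(** The half of the Cauchy-Binet formula given by multilinearity: the sum is
    over all functions, as in [maximal_minors]. *)
Lemma det_mulmx_rowsub (R : comNzRingType) (m n : nat) (S : 'M[R]_(n, m))
    (A : 'M[R]_(m, n)) :
  \det (S *m A) =
    \sum_(f : {ffun 'I_n -> 'I_m}) (\prod_i S i (f i)) * \det (rowsub f A).
Proof.
pose SA (s : 'S_n) i j := S i j * A j (s i).
transitivity (\sum_(f : {ffun 'I_n -> 'I_m})
    \sum_(s : 'S_n) (-1) ^+ s * \prod_i SA s i (f i)).
  rewrite exchange_big; apply: eq_bigr => /= s _; rewrite -big_distrr /=.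
  congr (_ * _); rewrite -(bigA_distr_bigA (SA s)) /=.
  by apply: eq_bigr => i _; rewrite mxE.
apply: eq_bigr => f _; rewrite big_distrr /=; apply: eq_bigr => s _.
rewrite /SA big_split /= mulrCA; congr (_ * (_ * _)).
by apply: eq_bigr => i _; rewrite mxE.
Qed.

(** By Laplace expansion along the columns of [K] all that remains are
    determinants of square combinations of rows of [A], which are combinations
    of maximal minors. *)
Lemma common_divisor_det_row_mx (R : comNzRingType) (m n N : nat) (e : R)
    (A : 'M[R]_(m, n)) (K : 'M[R]_(N + n, N)) (G : 'M[R]_(N + n, m)) :
  (forall s, maximal_minors A s -> divides e s) ->
  divides e (\det (row_mx K (G *m A))).
Proof.
move=> eA; elim: N K G => [|N IHN] K G.
  suff -> : row_mx K (G *m A) = G *m A.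
    rewrite det_mulmx_rowsub; apply: divides_sum => f.
    by apply/divides_mull/eA; exists f.
  apply/matrixP=> i j; rewrite mxE; case: splitP => [[]//|j' jj'].
  by congr (_ i _); apply: val_inj.
rewrite (expand_det_col _ (lshift n ord0)); apply: divides_sum => i.
apply/divides_mull/divides_mull.
rewrite col'Kl row'_row_mx.
have -> : row' i (G *m A) = row' i G *m A.
  by apply/matrixP=> p q; rewrite !mxE; apply: eq_bigr => l _; rewrite mxE.
exact: IHN.
Qed.

Lemma lift_presentation (R : comNzRingType) (U : lmodType R) (n N : nat)
    (f : {linear 'rV[R]_n -> U}) (g : {linear 'rV[R]_N -> U}) :
  (forall h, exists v, g v = h) ->
  exists P : 'M[R]_(n, N), forall v, f v = g (v *m P).
Proof.
move=> g_surj.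
have [P PE] := fin_all_exists (fun i : 'I_n => g_surj (f (delta_mx 0 i))).
exists (\matrix_i P i) => v.
rewrite {1}[v]row_sum_delta mulmx_sum_row !linear_sum /=.
by apply: eq_bigr => i _; rewrite !linearZ /= rowK PE.
Qed.

Lemma row_span_factor (R : comNzRingType) (k m n : nat) (X : 'M[R]_(k, n))
    (A : 'M[R]_(m, n)) :
  (forall v : 'rV[R]_k, exists u, v *m X = u *m A) -> exists Z, X = Z *m A.
Proof.
move=> XA.
have [Z ZE] := fin_all_exists (fun i : 'I_k => XA (delta_mx 0 i)).
exists (\matrix_i Z i); apply/row_matrixP => i.
by rewrite row_mul rowK -ZE rowE.
Qed.

(** Invariance of the Fitting ideal, in the case where one of the two
    presentations is square.  Let the rows of [P] and [Q] express the generators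
    of each presentation [A], [M] in terms of those of the other.  The relations
    among all these generators are spanned by the rows of [A 0; - Q 1] and also
    by those of [1 - P; 0 M].  Writing each family in terms of the other makes
    the minors of [A] multiples of [det M], and [det M] a determinant of the
    form treated in [common_divisor_det_row_mx]. *)
Lemma order_square_presentation (R : comNzRingType) (U : lmodType R) (N : nat)
    (M : 'M[R]_N) (d : R) :
  is_presentation_matrix U M -> is_order U d ->
  divides d (\det M) /\ divides (\det M) d.
Proof.
move=> [g [g_surj g_ker]] [m [n [A [[f [f_surj f_ker]] [d_minors d_gcd]]]]].
have [P PE] := lift_presentation f g_surj.
have [Q QE] := lift_presentation g f_surj.
have [Z ZE] : exists Z, A *m P = Z *m M.
  apply: row_span_factor => v; apply/g_ker.
  by rewrite mulmxA -PE; apply/f_ker; exists v.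
have [Y YE] : exists Y, M *m Q = Y *m A.
  apply: row_span_factor => v; apply/f_ker.
  by rewrite mulmxA -QE; apply/g_ker; exists v.
have [S SE] : exists S, 1%:M - Q *m P = S *m M.
  apply: row_span_factor => v; apply/g_ker.
  by rewrite mulmxBr mulmx1 linearB /= mulmxA -PE -QE subrr.
have [T TE] : exists T, 1%:M - P *m Q = T *m A.
  apply: row_span_factor => v; apply/f_ker.
  by rewrite mulmxBr mulmx1 linearB /= mulmxA -QE -PE subrr.
split; last first.
  apply: d_gcd => _ [h ->].
  exists (\det (block_mx (rowsub h A) (rowsub h 1%:M *m Z) (- Q) S)).
  rewrite -[\det M]mul1r -[X in X * \det M](det1 R n).
  rewrite -(det_ublock _ (- P)) -det_mulmx mulmx_block.
  rewrite !mulmx0 !addr0 !mulmx1 -[_ *m Z *m _]mulmxA -ZE.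
  have -> : rowsub h A *m - P + rowsub h 1%:M *m (A *m P) = 0.
    by rewrite mulmxN !mul_rowsub_mx mul1mx addNr.
  have -> : - Q *m - P + S *m M = 1%:M.
    by rewrite mulNmx mulmxN opprK -SE addrC subrK.
  by rewrite det_lblock det1 mulr1.
have dA : \det (row_mx (col_mx M (- P)) (col_mx Y T *m A)) = \det M.
  rewrite mul_col_mx -YE -TE -block_mxEh.
  rewrite -[\det M]mulr1 -[X in _ * X](det1 R n) -(det_lblock M (- P)).
  rewrite -[RHS]mulr1 -[X in _ = _ * X](det1 R (N + n)).
  have <- : \det (block_mx 1%:M Q 0 1%:M : 'M[R]_(N + n)) =
      \det (1%:M : 'M[R]_(N + n)).
    by rewrite det_ublock !det1 mulr1.
  rewrite -det_mulmx mulmx_block !mulmx0 !mulmx1 !addr0 mulNmx.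
  by rewrite [- _ + _]addrC.
by rewrite -dA; apply: common_divisor_det_row_mx.
Qed.

Lemma square_presentation_order (R : comNzRingType) (U : lmodType R) (N : nat)
    (M : 'M[R]_N) :
  is_presentation_matrix U M -> is_order U (\det M).
Proof.
move=> UM; exists N, N, M; split=> //; split=> [_ [f ->]|e eM].
  exists (\det (rowsub f 1%:M)).
  by rewrite -det_mulmx mul_rowsub_mx mul1mx.
by apply: eM; exists id; congr (\det _); apply/matrixP=> i j;
  rewrite mxE.
Qed.

(** * Evaluation of Laurent polynomials at t = 1 *)

Local Notation frac := (@tofrac {poly int}).

Lemma laurent_fracP (f : laurent) :
  exists n (p : {poly int}), val f = frac p / frac 'X ^+ n.
Proof. exact: (asboolW (laurentP f)). Qed.

Lemma laurent_at1_zmod_morphism : zmod_morphism laurent_at1.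
Proof.
move=> f g; have [m [p pE]] := laurent_fracP f.
have [n [q qE]] := laurent_fracP g.
have fgE : val (f - g) = frac (p * 'X^n - q * 'X^m) / frac 'X ^+ (m + n).
  rewrite raddfB /= pE qE tofracB !tofracM !tofracXn exprD mulrBl.
  rewrite -mulf_div divff ?fracX_unit // mulr1 [_ ^+ m * _]mulrC.
  by rewrite -mulf_div divff ?fracX_unit // mulr1.
rewrite (laurent_at1E fgE) (laurent_at1E pE) (laurent_at1E qE).
by rewrite !hornerE !expr1n !mulr1.
Qed.

Lemma laurent_at1_monoid_morphism : monoid_morphism laurent_at1.
Proof.
split=> [|f g].
  have E1 : val (1 : laurent) = frac 1 / frac 'X ^+ 0.
    by rewrite tofrac1 expr0 divr1.
  by rewrite (laurent_at1E E1) hornerC.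
have [m [p pE]] := laurent_fracP f; have [n [q qE]] := laurent_fracP g.
have fgE : val (f * g) = frac (p * q) / frac 'X ^+ (m + n).
  by rewrite rmorphM /= pE qE tofracM exprD mulf_div.
by rewrite (laurent_at1E fgE) (laurent_at1E pE) (laurent_at1E qE) hornerM.
Qed.

HB.instance Definition _ :=
  GRing.isZmodMorphism.Build laurent int laurent_at1 laurent_at1_zmod_morphism.
HB.instance Definition _ :=
  GRing.isMonoidMorphism.Build laurent int laurent_at1
    laurent_at1_monoid_morphism.

Lemma laurent_tD (m n : int) : laurent_t (m + n) = laurent_t m * laurent_t n.
Proof.
by apply: val_inj; rewrite rmorphM /= expfzDr // tofrac_eq0 polyX_eq0.
Qed.

Lemma laurent_t0 : laurent_t 0 = 1.
Proof. by apply: val_inj; rewrite /= expr0z. Qed.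

Lemma laurent_at1_t (z : int) : laurent_at1 (laurent_t z) = 1.
Proof.
case: z => n.
  have E : val (laurent_t n) = frac 'X^n / frac 'X ^+ 0.
    by rewrite /= tofracXn expr0 divr1.
  by rewrite (laurent_at1E E) hornerXn expr1n.
have E : val (laurent_t (Negz n)) = frac 1 / frac 'X ^+ n.+1.
  by rewrite /= tofrac1 div1r NegzE -exprnN.
by rewrite (laurent_at1E E) hornerC.
Qed.

(** Associates have equal values at 1 up to sign, units of the Laurent ring
    being sent to units of [int]. *)
Lemma normr_laurent_at1_associates (d e : laurent) :
  divides d e -> divides e d -> `|laurent_at1 d| = `|laurent_at1 e|.
Proof.
move=> [q eE] [q' dE]; rewrite -!abszE; congr Posz; apply/eqP.
rewrite eqn_dvd; apply/andP; split.
  by rewrite eE rmorphM abszM dvdn_mull.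
by rewrite dE rmorphM abszM dvdn_mull.
Qed.

(** * Fox calculus in matrices *)

Section FoxMatrices.
Variables (R : comNzRingType) (n : nat) (act : word -> 'M[R]_n).

Definition word_action : Prop :=
  [/\ act [::] = 1%:M,
      forall u v, act (u ++ v) = act u *m act v &
      forall l, act [:: l; inv_letter l] = 1%:M].

(** The image of the formal sum [fox g u] under the linear extension of
    [act]. *)
Definition fox_mx (g : gen) (u : word) : 'M[R]_n :=
  \sum_(cv <- fox g u) cv.1%:~R *: act cv.2.

Hypothesis actP : word_action.

Let act_nil : act [::] = 1%:M. Proof. by case: actP. Qed.
Let act_cat u v : act (u ++ v) = act u *m act v. Proof. by case: actP. Qed.
Let act_cons l u : act (l :: u) = act [:: l] *m act u.
Proof. by rewrite -act_cat. Qed.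

Lemma act_letterV l : act [:: l] *m act [:: inv_letter l] = 1%:M.
Proof. by rewrite -act_cat; case: actP => _ _ ->. Qed.

Lemma act_Vletter l : act [:: inv_letter l] *m act [:: l] = 1%:M.
Proof. by rewrite -{2}[l]inv_letterK act_letterV. Qed.

Lemma act_invV u : act u *m act (inv_word u) = 1%:M.
Proof.
elim: u => [|l u IHu]; first by rewrite act_nil mulmx1.
rewrite -cat1s inv_word_cat !act_cat -mulmxA (mulmxA (act u)) IHu mul1mx.
exact: act_letterV.
Qed.

Lemma act_Vinv u : act (inv_word u) *m act u = 1%:M.
Proof. by rewrite -{2}[u]inv_wordK act_invV. Qed.

Lemma fox_mx_nil g : fox_mx g [::] = 0.
Proof. by rewrite /fox_mx big_nil. Qed.

Lemma fox_mx_letter g l :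
  fox_mx g [:: l] =
    if l.1 == g then (if l.2 then 1%:M else - act [:: l]) else 0.
Proof.
rewrite /fox_mx /= cats0; case: (l.1 == g); last by rewrite big_nil.
by case: l.2; rewrite big_seq1 ?scale1r ?act_nil // rmorphN scaleN1r.
Qed.

Lemma fox_mx_cons g l u :
  fox_mx g (l :: u) = fox_mx g [:: l] + act [:: l] *m fox_mx g u.
Proof.
rewrite {1 2}/fox_mx /= cats0 big_cat /= big_map mulmx_sumr; congr (_ + _).
by apply: eq_bigr => cv _; rewrite /= (act_cons l cv.2) scalemxAr.
Qed.

Lemma fox_mx_cat g u v : fox_mx g (u ++ v) = fox_mx g u + act u *m fox_mx g v.
Proof.
elim: u => [|l u IHu] /=; first by rewrite fox_mx_nil act_nil mul1mx add0r.
rewrite (fox_mx_cons g l u) (fox_mx_cons g l (u ++ v)) IHu mulmxDr addrA.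
by rewrite (act_cons l u) mulmxA.
Qed.

Lemma fox_mx_inv g u :
  fox_mx g (inv_word u) = - (act (inv_word u) *m fox_mx g u).
Proof.
elim: u => [|l u IHu]; first by rewrite fox_mx_nil mulmx0 oppr0.
rewrite -cat1s inv_word_cat fox_mx_cat IHu act_cat -[RHS]mulmxN -mulmxA.
rewrite -mulmxN -mulmxDr fox_mx_cat; congr (_ *m _).
rewrite mulmxN mulmxDr mulmxA act_Vletter mul1mx opprD addrC; congr (_ - _).
rewrite !fox_mx_letter /=; case: (l.1 == g); last by rewrite mulmx0 oppr0.
by case: l.2; rewrite /= ?mulmx1 // mulmxN opprK act_Vletter.
Qed.

(** The fundamental formula of the Fox calculus: the image of the chain with
    boundary [u - 1]. *)
Lemma fox_mx_fundamental u :
  fox_mx gx u *m (act [:: (gx, true)] - 1%:M)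
    + fox_mx gy u *m (act [:: (gy, true)] - 1%:M) = act u - 1%:M.
Proof.
elim: u => [|l u IHu]; first by rewrite !fox_mx_nil !mul0mx act_nil subrr addr0.
rewrite !(fox_mx_cons _ l u) !mulmxDl addrACA -!mulmxA -mulmxDr IHu.
rewrite [X in _ + X = _]mulmxBr mulmx1 -(act_cons l u) [LHS]addrC.
rewrite -[RHS](subrKA (act [:: l])); congr (_ + _).
rewrite !fox_mx_letter /gx /gy; case: l => [[] []] /=;
  rewrite ?mul0mx ?add0r ?addr0 ?mul1mx // mulNmx mulmxBr mulmx1 opprB.
  by rewrite (act_Vletter (gy, true)).
by rewrite (act_Vletter (gx, true)).
Qed.

Lemma fox_mx_relation g u v : act u = act v ->
  fox_mx g (u ++ inv_word v) = fox_mx g u - fox_mx g v.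
Proof.
move=> uv; rewrite fox_mx_cat fox_mx_inv mulmxN mulmxA uv act_invV.
by rewrite mul1mx.
Qed.

Lemma fox_mx_rot g u v : act (u ++ v) = 1%:M ->
  fox_mx g (v ++ u) = act v *m fox_mx g (u ++ v).
Proof.
move=> uv1; rewrite !fox_mx_cat mulmxDr addrC mulmxA.
have -> : act v *m act u = 1%:M by apply: mulmx1C; rewrite -act_cat.
by rewrite mul1mx.
Qed.

Section Intertwiner.
Variables (K : 'M[R]_n) (s : letter -> letter).
Hypothesis Ks : forall l, K *m act [:: l] = act [:: s l] *m K.

Lemma act_intertwine u : K *m act u = act (map s u) *m K.
Proof.
elim: u => [|l u IHu] /=; first by rewrite act_nil mulmx1 mul1mx.
by rewrite !(act_cons _ u, act_cons _ (map s u)) mulmxA Ks -!mulmxA IHu.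
Qed.

End Intertwiner.

Lemma fox_mx_comm (B : 'M[R]_n) g u :
  (forall l, B *m act [:: l] = act [:: l] *m B) ->
  B *m fox_mx g u = fox_mx g u *m B.
Proof.
move=> BC; elim: u => [|l u IHu]; first by rewrite fox_mx_nil mulmx0 mul0mx.
rewrite fox_mx_cons mulmxDr mulmxDl mulmxA BC -!mulmxA IHu; congr (_ + _).
rewrite fox_mx_letter; case: ifP => _; last by rewrite mulmx0 mul0mx.
by case: l.2; rewrite ?mulmx1 ?mul1mx // mulmxN BC mulNmx.
Qed.

Definition swap_inv_letter (l : letter) : letter := (~~ l.1, ~~ l.2).

(** The chain rule for the endomorphism x |-> y^-1, y |-> x^-1 of the free
    group, realized by conjugation by [K]. *)
Lemma fox_mx_swap_inv (K : 'M[R]_n) u :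
  (forall l, K *m act [:: l] = act [:: swap_inv_letter l] *m K) ->
  fox_mx gy (map swap_inv_letter u) *m act [:: (gy, true)] *m K
    = - (K *m fox_mx gx u).
Proof.
move=> Ks; elim: u => [|l u IHu] /=.
  by rewrite !fox_mx_nil mulmx0 !mul0mx oppr0.
rewrite !(fox_mx_cons _ _ u, fox_mx_cons _ _ (map _ u)) !mulmxDl -!mulmxA.
rewrite -mulmxA in IHu; rewrite IHu mulmxDr opprD mulmxN !mulmxA -Ks; congr (_ + _).
rewrite !fox_mx_letter /gx /gy; case: l => [[] []] /=;
  rewrite ?mulmx0 ?mul0mx ?oppr0 ?mulmx1 ?mul1mx //.
  by rewrite !mulNmx (act_Vletter (gy, true)) mul1mx.
by rewrite mulmxN opprK Ks.
Qed.

End FoxMatrices.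

(** * The relator of a 2-bridge knot *)

Lemma divzN1 (a : nat) (m : int) : (0 < a)%N ->
  ((- m - 1) %/ a%:Z)%Z = - (m %/ a%:Z)%Z - 1.
Proof.
move=> a0; have a0' : a%:Z != 0 by case: (a) a0.
set q := (m %/ a)%Z; set r := (m %% a)%Z.
have -> : - m - 1 = (- q - 1) * a + (a%:Z - 1 - r).
  by rewrite (divz_eq m a) -/q -/r; ring.
rewrite divzMDl // [X in _ + X]divz_small ?addr0 //.
have : 0 <= r := modz_ge0 m a0'; have : r < a by exact: ltz_pmod.
by move: r => r; lia.
Qed.

Lemma divz_pred (a : nat) (m : int) : (0 < a)%N -> ~~ (a %| m)%Z ->
  ((m - 1) %/ a%:Z)%Z = (m %/ a%:Z)%Z.
Proof.
move=> a0; have a0' : a%:Z != 0 by case: (a) a0.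
rewrite (_ : (a %| m)%Z = ((m %% a)%Z == 0)); last first.
  exact/dvdz_mod0P/eqP.
move: (divz_eq m a); set q := (m %/ a)%Z; set r := (m %% a)%Z => mE r0.
have -> : m - 1 = q * a + (r - 1) by rewrite mE; ring.
rewrite divzMDl // [X in _ + X]divz_small ?addr0 //.
have : 0 <= r := modz_ge0 m a0'; have : r < a by exact: ltz_pmod.
by move: r r0 {mE} => r; lia.
Qed.

Lemma antisymmetric_word (L : nat -> letter) (a : nat) : (0 < a)%N ->
  (forall i, (0 < i < a)%N -> L (a.*2 - i)%N = inv_letter (L i)) ->
  map L (iota 1 a.*2) =
    map L (iota 1 a.-1) ++ [:: L a] ++ inv_word (map L (iota 1 a.-1))
      ++ [:: L a.*2].
Proof.
case: a => // a _ LV.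
have -> : inv_word (map L (iota 1 a)) = map L (iota a.+2 a).
  apply: (@eq_from_nth _ (L 0)); rewrite size_rev !size_map !size_iota // => i ia.
  rewrite nth_rev ?size_map ?size_iota // -map_comp.
  rewrite (nth_map 0) ?size_iota; last lia.
  rewrite (nth_map 0) ?size_iota // !nth_iota //; last lia.
  by rewrite /= -LV; [congr L; lia | lia].
have -> : iota 1 a.+1.*2 =
    iota 1 a ++ [:: a.+1] ++ iota a.+2 a ++ [:: a.+1.*2].
  have {1}-> : a.+1.*2 = (a + (1 + (a + 1)))%N by lia.
  rewrite !iotaD /=.
  by do ![congr (_ ++ _) || congr (_ :: _) || congr (iota _ _)]; lia.
by rewrite !map_cat.
Qed.

Section BridgeWord.
Variable k : two_bridge_knot.
Local Notation a := (alpha k).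
Local Notation b := (beta k).

Let a_gt0 : (0 < a)%N. Proof. exact: ltnW (alpha_gt1 k). Qed.
Let a_neq0 : a%:Z != 0. Proof. by case: (a) a_gt0. Qed.

Definition even_floor (m : int) : bool := ~~ odd `|(m %/ a%:Z)%Z|%N.

Lemma even_floorDM (m z : int) :
  even_floor (m + z * a) = even_floor m (+) odd `|z|%N.
Proof. by rewrite /even_floor addrC divzMDl //; lia. Qed.

Lemma even_floorN1 (m : int) : even_floor (- m - 1) = ~~ even_floor m.
Proof. by rewrite /even_floor divzN1 //; lia. Qed.

Lemma even_floor_pred (m : int) : ~~ (a %| m)%Z ->
  even_floor (m - 1) = even_floor m.
Proof. by move=> am; rewrite /even_floor divz_pred. Qed.

Lemma dvd_alpha_mul_beta (i : nat) : (0 < i < a)%N -> ~~ (a %| i%:Z * b)%Z.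
Proof.
move=> /andP[i0 ia]; rewrite dvdzE abszM /= Gauss_dvdl ?alpha_beta_coprime //.
by apply/negP => /(dvdn_leq i0); rewrite leqNgt ia.
Qed.

(** The exponents of [bridge_word] are the signs of sin (pi i beta / alpha).
    Replacing i beta by i beta - 1 changes nothing at indices that are not
    multiples of alpha, and at alpha and 2 alpha it produces the letters x and
    y^-1 of the relator: the whole relator follows a single rule. *)
Definition relator_letter (i : nat) : letter :=
  (if odd i then gx else gy, even_floor (i%:Z * b - 1)).

(** Without the shift by 1 the rule gives the opposite signs at alpha and
    2 alpha. *)
Definition swap_relator_letter (i : nat) : letter :=
  (if odd i then gy else gx, even_floor (i%:Z * b)).

Definition swap_letter (l : letter) : letter := (~~ l.1, l.2).

Definition swap_word : word := map swap_letter (bridge_word k).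

Lemma bridge_word_iota : bridge_word k = map relator_letter (iota 1 a.-1).
Proof.
apply/eq_in_map => i; rewrite mem_iota => iP.
by rewrite /relator_letter even_floor_pred //; apply: dvd_alpha_mul_beta; lia.
Qed.

Lemma swap_word_iota : swap_word = map swap_relator_letter (iota 1 a.-1).
Proof.
rewrite /swap_word /bridge_word -map_comp; apply: eq_map => i.
by rewrite /swap_letter /swap_relator_letter /=; case: (odd i).
Qed.

Lemma bridge_relator_iota :
  bridge_relator k = map relator_letter (iota 1 a.*2).
Proof.
rewrite antisymmetric_word //; last first.
  move=> i iP; rewrite /relator_letter /inv_letter /=; congr (_, _).
    by rewrite oddB ?odd_double //; lia.
  have -> : (a.*2 - i)%:Z * b - 1 = - (i%:Z * b) - 1 + (2 * b) * a.
    by rewrite -subzn -?addnn ?PoszD; [ring | lia].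
  rewrite even_floorDM even_floorN1 even_floor_pred; last exact: dvd_alpha_mul_beta.
  by lia.
rewrite -bridge_word_iota /bridge_relator; congr (_ ++ [:: _] ++ _ ++ [:: _]).
  rewrite /relator_letter alpha_odd; congr (_, _).
  have -> : a%:Z * b - 1 = - 0 - 1 + b * a by ring.
  by rewrite even_floorDM even_floorN1 /even_floor div0z beta_odd.
rewrite /relator_letter odd_double; congr (_, _).
have -> : (a.*2)%:Z * b - 1 = - 0 - 1 + (2 * b) * a by rewrite -addnn PoszD; ring.
by rewrite even_floorDM even_floorN1 /even_floor div0z abszM oddM.
Qed.

Lemma swap_relator_iota :
  swap_word ++ [:: (gy, false)] ++ inv_word swap_word ++ [:: (gx, true)] =
    map swap_relator_letter (iota 1 a.*2).
Proof.
rewrite antisymmetric_word //; last first.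
  move=> i iP; rewrite /swap_relator_letter /inv_letter /=; congr (_, _).
    by rewrite oddB ?odd_double //; lia.
  have -> : (a.*2 - i)%:Z * b = - (i%:Z * b - 1) - 1 + (2 * b) * a.
    by rewrite -subzn -?addnn ?PoszD; [ring | lia].
  rewrite even_floorDM even_floorN1 even_floor_pred; last exact: dvd_alpha_mul_beta.
  by lia.
rewrite -swap_word_iota; congr (_ ++ [:: _] ++ _ ++ [:: _]).
  rewrite /swap_relator_letter alpha_odd; congr (_, _).
  have -> : a%:Z * b = 0 + b * a by ring.
  by rewrite even_floorDM /even_floor div0z beta_odd.
rewrite /swap_relator_letter odd_double; congr (_, _).
have -> : (a.*2)%:Z * b = 0 + (2 * b) * a by rewrite -addnn PoszD; ring.
by rewrite even_floorDM /even_floor div0z abszM oddM.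
Qed.

(** The exponents of [bridge_word] form a palindrome, and as alpha is odd the
    index alpha - i has the other generator. *)
Lemma swap_word_rev : swap_word = rev (bridge_word k).
Proof.
rewrite swap_word_iota bridge_word_iota.
apply: (@eq_from_nth _ (gx, true)); rewrite ?size_rev !size_map !size_iota // => i ia.
rewrite nth_rev ?size_map ?size_iota //.
rewrite (nth_map 0) ?size_iota // (nth_map 0) ?size_iota; last lia.
rewrite !nth_iota //; last lia.
have -> : (1 + (a.-1 - i.+1) = a - (1 + i))%N by lia.
rewrite /relator_letter /swap_relator_letter oddB ?alpha_odd; last lia.
congr (_, _); first by case: (odd _).
have -> : (a - (1 + i))%:Z * b - 1 = - ((1 + i)%:Z * b) - 1 + b * a.
  by rewrite -subzn ?PoszD; [ring | lia].
by rewrite even_floorDM even_floorN1 beta_odd addbT negbK.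
Qed.

(** Let j be an inverse of beta modulo 2 alpha.  Shifting the index by j turns
    i beta - 1 into i beta modulo 2 alpha, and exchanges the generators as j is
    odd.  Hence the relation W* y = x W*, obtained from W x = y W by exchanging
    x and y, holds in the knot group.  This is the step that singles out 2-bridge
    words among all words with palindromic exponents. *)
Lemma swap_relator_rot : exists j,
  rot j (bridge_relator k) =
    swap_word ++ [:: (gy, false)] ++ inv_word swap_word ++ [:: (gx, true)].
Proof.
have [j [j_le j_odd [m jE]]] : exists j : nat,
    [/\ (j <= a.*2)%N, odd j & exists m : int, j%:Z * b = 1 + m * (2 * a%:Z)].
  have a2_neq0 : 2 * a%:Z != 0 by rewrite mulf_neq0.
  have : coprimez b (2 * a%:Z).
    rewrite coprimezE abszM coprimeMr coprimen2 beta_odd.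
    by rewrite coprime_sym alpha_beta_coprime.
  move=> /coprimezP[[u v] /= uvE].
  have r0 : 0 <= (u %% (2 * a%:Z))%Z := modz_ge0 u a2_neq0.
  have ra : (u %% (2 * a%:Z))%Z < 2 * a%:Z by apply: ltz_pmod; lia.
  exists `|(u %% (2 * a%:Z))%Z|%N.
  have jE : `|(u %% (2 * a%:Z))%Z|%:Z * b =
      1 + (- v - (u %/ (2 * a%:Z))%Z * b) * (2 * a%:Z).
    rewrite gez0_abs //; transitivity
      (u * b + v * (2 * a%:Z) + (- v - (u %/ (2 * a%:Z))%Z * b) * (2 * a%:Z));
      last by rewrite uvE.
    move: (divz_eq u (2 * a%:Z)).
    by move: (u %/ _)%Z (u %% _)%Z => q r ->; ring.
  split; first by move: ra r0; set r := (u %% _)%Z; lia.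
    have : odd `|(1 + (- v - (u %/ (2 * a%:Z))%Z * b) * (2 * a%:Z))%R|%N.
      by set z := - v - _; lia.
    by rewrite -jE abszM oddM => /andP[].
  by eexists; exact: jE.
exists j; rewrite bridge_relator_iota swap_relator_iota /rot.
rewrite -map_drop -map_take drop_iota take_iota (minn_idPl j_le).
have -> : map relator_letter (iota 1 j) =
    map relator_letter (iota (1 + j + (a.*2 - j)) j).
  have -> : (1 + j + (a.*2 - j) = a.*2 + 1)%N by lia.
  rewrite iotaDl -map_comp; apply: eq_map => i /=.
  rewrite /relator_letter oddD odd_double; congr (_, _).
  have -> : (a.*2 + i)%:Z * b - 1 = i%:Z * b - 1 + (2 * b) * a.
    by rewrite -addnn !PoszD; ring.
  by rewrite even_floorDM abszM oddM addbF.
rewrite -map_cat -iotaD subnK // [(1 + j)%N]addnC iotaDl -map_comp.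
apply: eq_map => i /=.
rewrite /relator_letter /swap_relator_letter oddD j_odd; congr (_, _).
  by case: (odd i).
have -> : (j + i)%:Z * b - 1 = i%:Z * b + (2 * m) * a.
  by rewrite PoszD mulrDl jE; ring.
by rewrite even_floorDM abszM oddM addbF.
Qed.

End BridgeWord.

(** * Total parabolic representations *)

Lemma mulmxNN1C (R : comNzRingType) (n : nat) (A B : 'M[R]_n) :
  A *m B = - 1%:M -> B *m A = - 1%:M.
Proof.
move=> AB; apply: oppr_inj; rewrite opprK -mulNmx; apply: mulmx1C.
by rewrite mulmxN AB opprK.
Qed.

Section TotalRepresentation.
Variables (k : two_bridge_knot) (d : nat) (C : 'M[int]_d).
Variable act : word -> 'M[int]_(d + d).
Hypothesis actP : word_action act.
Hypothesis act_gen : forall g, act [:: (g, true)] = riley_matrix C g.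
Hypothesis act_relator : act (bridge_relator k) = 1%:M.

Let act_cat u v : act (u ++ v) = act u *m act v. Proof. by case: actP. Qed.
Let act_nil : act [::] = 1%:M. Proof. by case: actP. Qed.

Local Notation W := (bridge_word k).
Local Notation Ws := (swap_word k).
Local Notation b := (ursubmx (act W)).
Local Notation e := (drsubmx (act W)).
Local Notation f := (ursubmx (fox_mx act gx W)).

Lemma act_x : act [:: (gx, true)] = block_mx 1%:M 1%:M 0 1%:M.
Proof. exact: act_gen. Qed.

Lemma act_y : act [:: (gy, true)] = block_mx 1%:M 0 C 1%:M.
Proof. exact: act_gen. Qed.

Lemma act_letterV_unique g A :
  act [:: (g, true)] *m A = 1%:M -> act [:: (g, false)] = A.
Proof.
move=> gA; rewrite -[LHS]mulmx1 -gA mulmxA.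
by rewrite (act_Vletter actP (g, true)) mul1mx.
Qed.

Lemma act_xV : act [:: (gx, false)] = block_mx 1%:M (- 1%:M) 0 1%:M.
Proof.
apply: act_letterV_unique; rewrite act_x mulmx_block.
rewrite !(mulmx0, mul0mx, mulmx1, mul1mx, addr0, add0r) addNr.
by rewrite -scalar_mx_block.
Qed.

Lemma act_yV : act [:: (gy, false)] = block_mx 1%:M 0 (- C) 1%:M.
Proof.
apply: act_letterV_unique; rewrite act_y mulmx_block.
rewrite !(mulmx0, mul0mx, mulmx1, mul1mx, addr0, add0r) subrr.
by rewrite -scalar_mx_block.
Qed.

Lemma act_eq_of_relation u v : act (u ++ inv_word v) = 1%:M -> act u = act v.
Proof.
move=> uv; rewrite -[LHS]mulmx1 -(act_Vinv actP v) mulmxA -act_cat uv.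
exact: mul1mx.
Qed.

Lemma bridge_relator_split :
  bridge_relator k = (W ++ [:: (gx, true)]) ++ inv_word ((gy, true) :: W).
Proof. by rewrite -[_ :: W]cat1s inv_word_cat -catA. Qed.

Lemma act_relation : act W *m act [:: (gx, true)] = act [:: (gy, true)] *m act W.
Proof.
rewrite -!act_cat; apply: act_eq_of_relation.
by rewrite -bridge_relator_split.
Qed.

(** Comparing the blocks of [W x] and [y W]. *)
Lemma act_bridge_word : act W = block_mx 0 b (C *m b) e.
Proof.
have := act_relation; rewrite act_x act_y -{1 2}[act W]submxK !mulmx_block.
rewrite !mulmx1 !mulmx0 !mul1mx !mul0mx !addr0.
case/eq_block_mx => _ /(canRL (addrK _)); rewrite subrr => a0 _.
move=> /(canRL (addrK _)); rewrite addrK => c0.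
by rewrite -{1}[act W]submxK a0 c0.
Qed.

(** Conjugation by this matrix realizes the automorphism x |-> y^-1,
    y |-> x^-1 of the free group. *)
Definition swap_inv_mx : 'M[int]_(d + d) := block_mx 0 1%:M (- C) 0.
Local Notation K := swap_inv_mx.

Lemma swap_inv_mx_letter l : K *m act [:: l] = act [:: swap_inv_letter l] *m K.
Proof.
case: l => [[] []]; rewrite /swap_inv_letter /=
  ?(act_x, act_y, act_xV, act_yV) /K !mulmx_block;
  by rewrite !(mulmx0, mul0mx, mulmx1, mul1mx, addr0, add0r, mulmxN, mulNmx, opprK).
Qed.

Lemma map_swap_inv_bridge_word : map swap_inv_letter W = inv_word W.
Proof.
by rewrite /inv_word -map_rev -swap_word_rev /swap_word -map_comp.
Qed.

Lemma act_bridge_word_swap_inv : act W *m K *m act W = K.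
Proof.
rewrite -mulmxA (act_intertwine actP swap_inv_mx_letter).
by rewrite map_swap_inv_bridge_word mulmxA act_invV // mul1mx.
Qed.

(** This makes C equal to - b^-2: in particular C is unimodular and commutes
    with b. *)
Lemma bCb : b *m (C *m b) = - 1%:M.
Proof.
have WKW := act_bridge_word_swap_inv.
move: WKW; rewrite {1 2}act_bridge_word /K !mulmx_block.
case/eq_block_mx => _ + _ _.
rewrite !(mulmx0, mul0mx, mulmx1, mul1mx, addr0, add0r) => bCb1.
by rewrite -bCb1 mulmxN mulNmx opprK mulmxA.
Qed.

Lemma Cbb : C *m (b *m b) = - 1%:M.
Proof. by rewrite mulmxA; apply/mulmxNN1C/bCb. Qed.

Lemma bC_comm : b *m C = C *m b.
Proof.
have bbC : b *m (b *m C) = - 1%:M by apply: mulmxNN1C; rewrite -mulmxA bCb.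
apply: oppr_inj; transitivity (C *m (b *m b) *m (b *m C)).
  by rewrite Cbb mulNmx mul1mx.
by rewrite -!mulmxA bbC !mulmxN mulmx1.
Qed.

Lemma swap_inv_mx_unit : K *m block_mx 0 (b *m b) 1%:M 0 = 1%:M.
Proof.
rewrite /K mulmx_block !(mulmx0, mul0mx, mulmx1, mul1mx, addr0, add0r).
by rewrite mulNmx Cbb opprK -scalar_mx_block.
Qed.

Lemma act_x_sub_y : act [:: (gx, true)] - act [:: (gy, true)] = K.
Proof.
by rewrite act_x act_y opp_block_mx add_block_mx !subrr oppr0 addr0 add0r.
Qed.

(** The block diagonal matrix of b commutes with both generators, hence with all
    Fox matrices. *)
Lemma bf_comm : b *m f = f *m b.
Proof.
have b_letter l : block_mx b 0 0 b *m act [:: l] = act [:: l] *m block_mx b 0 0 b.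
  case: l => [[] []]; rewrite /= ?(act_x, act_y, act_xV, act_yV) !mulmx_block;
  by rewrite !(mulmx0, mul0mx, mulmx1, mul1mx, addr0, add0r, mulmxN, mulNmx)
    ?bC_comm.
have := fox_mx_comm actP gx W b_letter; rewrite -{1 2}[fox_mx act gx W]submxK.
rewrite !mulmx_block !(mul0mx, mulmx0) => /eq_block_mx[_ + _ _].
by rewrite !(addr0, add0r).
Qed.

Lemma fox_fundamental_top :
  ulsubmx (fox_mx act gx W) = b /\ ursubmx (fox_mx act gy W) *m C = - 1%:M.
Proof.
have := fox_mx_fundamental actP W.
have -> : act [:: (gx, true)] - 1%:M = block_mx 0 1%:M 0 0.
  by rewrite act_x (scalar_mx_block d d) opp_block_mx add_block_mx !subrr !subr0.
have -> : act [:: (gy, true)] - 1%:M = block_mx 0 0 C 0.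
  by rewrite act_y (scalar_mx_block d d) opp_block_mx add_block_mx !subrr !subr0.
rewrite {1}act_bridge_word (scalar_mx_block d d) opp_block_mx add_block_mx.
rewrite -{1}[fox_mx act gx W]submxK -{1}[fox_mx act gy W]submxK !mulmx_block.
rewrite !(mulmx0, mulmx1, addr0, add0r, oppr0) add_block_mx.
by rewrite !(addr0, add0r) => /eq_block_mx[].
Qed.

(** The chain rule gives the Fox derivative of W^-1 with respect to y in terms
    of that of W with respect to x, as [W^-1] is the image of [W] under
    x |-> y^-1, y |-> x^-1. *)
Lemma fox_bridge_word_y :
  ulsubmx (fox_mx act gy W) = 1%:M - b *m C *m f.
Proof.
have [xa yC] := fox_fundamental_top.
have := fox_mx_swap_inv actP W swap_inv_mx_letter.
rewrite map_swap_inv_bridge_word fox_mx_inv // !mulNmx => /oppr_inj.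
move=> /(congr1 (mulmx (act W))); rewrite !mulmxA act_invV // mul1mx.
rewrite act_y {1}act_bridge_word -{1}[fox_mx act gy W]submxK.
rewrite -{1}[fox_mx act gx W]submxK /K.
rewrite !mulmx_block => /eq_block_mx[_ + _ _].
rewrite !(mulmx0, mul0mx, mulmx1, mul1mx, addr0, add0r, mulmxN, mulNmx).
by rewrite yC => /eqP; rewrite subr_eq addrC => /eqP.
Qed.

Lemma fox_mx_bridge_relator g :
  fox_mx act g (bridge_relator k) =
    fox_mx act g W + act W *m fox_mx act g [:: (gx, true)]
      - (fox_mx act g [:: (gy, true)] + act [:: (gy, true)] *m fox_mx act g W).
Proof.
have rel : act (W ++ [:: (gx, true)]) = act ((gy, true) :: W).
  by rewrite act_cat act_relation -act_cat.
rewrite bridge_relator_split (fox_mx_relation actP _ rel).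
by rewrite (fox_mx_cat actP) (fox_mx_cons actP _ _ W).
Qed.

(** The Schur complement of the block - 1 in the sum of the two Fox derivatives
    of the relator. *)
Definition fox_pivot : 'M[int]_d :=
  e - C *m f - C *m (1%:M - b *m C *m f) *m b.

Lemma fox_mx_relator_x :
  fox_mx act gx (bridge_relator k) = block_mx 0 b 0 (e - C *m f).
Proof.
have [xa _] := fox_fundamental_top.
rewrite fox_mx_bridge_relator !fox_mx_letter //= mulmx1 add0r.
rewrite -{1 2}[fox_mx act gx W]submxK {1}act_bridge_word act_y mulmx_block.
rewrite !(mulmx0, mul0mx, mulmx1, mul1mx, addr0, add0r).
rewrite opp_block_mx !add_block_mx xa addr0.
congr (block_mx _ _ _ _); first exact: subrr.
- by rewrite addrAC subrr add0r.
- by rewrite [dlsubmx _ + _]addrC subrr.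
by rewrite opprD [_ + e]addrC addrA addrAC addrK.
Qed.

Lemma fox_mx_relator_y :
  fox_mx act gy (bridge_relator k) =
    block_mx (- 1%:M) 0 (- (C *m (1%:M - b *m C *m f))) 0.
Proof.
have [_ yC] := fox_fundamental_top.
rewrite fox_mx_bridge_relator !fox_mx_letter //= mulmx0 addr0.
rewrite -{1 2}[fox_mx act gy W]submxK act_y mulmx_block fox_bridge_word_y.
rewrite !(mulmx0, mul0mx, mulmx1, mul1mx, addr0, add0r) (scalar_mx_block d d).
rewrite (mulmxNN1C yC) !(opp_block_mx, add_block_mx).
congr (block_mx _ _ _ _).
- by rewrite opprD addrCA subrr addr0.
- by rewrite add0r subrr.
- by rewrite add0r opprD addrCA subrr addr0.
by rewrite addrA subrr add0r subrr.
Qed.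

(** C b C f b = - C f, since b C b = - 1 and b commutes with f. *)
Lemma fox_pivotE : fox_pivot = e - C *m b - (C *m f) *+ 2.
Proof.
rewrite /fox_pivot mulmxBr mulmx1 mulmxBl opprB addrA.
have -> : C *m (b *m C *m f) *m b = - (C *m f).
  rewrite -!mulmxA -bf_comm (mulmxA C b f) (mulmxA b) bCb.
  by rewrite mulNmx mul1mx mulmxN.
by rewrite mulr2n opprD !addrA -!(addrAC _ (- (C *m b))).
Qed.

Local Notation mod2 := (map_mx (intr : int -> 'F_2)).

Lemma mod2_oppmx (m n : nat) (A : 'M[int]_(m, n)) : mod2 (- A) = mod2 A.
Proof.
by apply/matrixP=> i j; rewrite !mxE rmorphN /= oppr_pchar2 // pchar_Fp.
Qed.

Lemma mod2_eq0 (m n : nat) (A : 'M[int]_(m, n)) :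
  mod2 A = 0 -> exists G, A = G *+ 2.
Proof.
move=> A0; exists (map_mx (fun z => (z %/ 2)%Z) A).
apply/matrixP=> i j; rewrite mulmxnE mxE.
have /matrixP/(_ i j) := A0; rewrite !mxE => /eqP.
rewrite -(dvdz_pcharf (pchar_Fp (isT : prime 2))) => /dvdzP[z ->].
by rewrite mulzK // mulr2n; ring.
Qed.

Lemma mod2_act_letter g s : mod2 (act [:: (g, s)]) = mod2 (act [:: (g, true)]).
Proof.
case: s => //; case: g; rewrite ?(act_x, act_y, act_xV, act_yV).
  by rewrite !map_block_mx mod2_oppmx.
by rewrite !map_block_mx mod2_oppmx.
Qed.

(** Modulo 2 both generators are involutions, so that an alternating word acts
    as a power of [x y]. *)
Lemma mod2_act_alternating n (s : nat -> bool) :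
  let XY := mod2 (act [:: (gx, true)]) *m mod2 (act [:: (gy, true)]) in
  let u := [seq (if odd i then gx else gy, s i) | i <- iota 1 n.*2] in
  mod2 (act u) *m XY = XY *m mod2 (act u).
Proof.
move=> XY; elim: n => [|n IHn] u.
  by rewrite /u /= act_nil map_mx1 mul1mx mulmx1.
rewrite {}/u doubleS -(addn2 n.*2) iotaD map_cat act_cat map_mxM.
have -> : mod2 (act [seq (if odd i then gx else gy, s i)
    | i <- iota (1 + n.*2) 2]) = XY.
  rewrite /= odd_double /= -cat1s act_cat map_mxM.
  by rewrite 2!mod2_act_letter.
by move: IHn => /= IHn; rewrite [RHS]mulmxA -IHn mulmxA.
Qed.

Lemma act_bridge_word_mod2 : exists G, e + C *m b = G *+ 2.
Proof.
apply: mod2_eq0; have := mod2_act_alternating (alpha k)./2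
  (fun i => even_floor k (i%:Z * beta k)).
have -> : (alpha k)./2.*2 = (alpha k).-1.
  by have := odd_double_half (alpha k); rewrite alpha_odd; lia.
rewrite -/(bridge_word k) /= -!map_mxM {1 2}act_bridge_word act_x act_y.
rewrite !mulmx_block !map_block_mx => /eq_block_mx[_ + _ _].
rewrite !(mulmx0, mul0mx, mulmx1, mul1mx, addr0, add0r).
rewrite mulmxDl mul1mx !map_mxD => bE.
have {bE} : mod2 (C *m b) + mod2 e = 0.
  by apply: (addrI (mod2 b)); rewrite addr0 addrA -bE.
by rewrite addrC.
Qed.

Lemma fox_pivot_even : exists F, fox_pivot = F *+ 2.
Proof.
have [G eG] := act_bridge_word_mod2; exists (G - C *m b - C *m f).
rewrite fox_pivotE !mulrnBl -eG; congr (_ - _).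
by rewrite mulr2n opprD addrA addrK.
Qed.

Lemma act_rot u v : act (u ++ v) = 1%:M -> act (v ++ u) = 1%:M.
Proof. by rewrite !act_cat; apply: mulmx1C. Qed.

(** The chain of the relation x W* = W* y, W* the word [swap_word k], is a
    multiple of that of the relator, of which it is a cyclic rotation. *)
Lemma swap_relation_chain :
  act [:: (gx, true)] *m act Ws = act Ws *m act [:: (gy, true)] /\
  exists U, forall g,
  fox_mx act g ((gx, true) :: Ws) - fox_mx act g (Ws ++ [:: (gy, true)]) =
    U *m fox_mx act g (bridge_relator k).
Proof.
have [j rotE] := swap_relator_rot k.
set r := bridge_relator k in rotE *.
have r1 : act (take j r ++ drop j r) = 1%:M by rewrite cat_take_drop.
have rr1 : act ((Ws ++ [:: (gy, false)] ++ inv_word Ws) ++ [:: (gx, true)]) = 1%:M.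
  by rewrite -!catA -rotE; apply: act_rot.
have splitE : [:: (gx, true)] ++ Ws ++ [:: (gy, false)] ++ inv_word Ws =
    ((gx, true) :: Ws) ++ inv_word (Ws ++ [:: (gy, true)]).
  by rewrite inv_word_cat.
have rel : act ((gx, true) :: Ws) = act (Ws ++ [:: (gy, true)]).
  by apply: act_eq_of_relation; rewrite -splitE; apply: act_rot.
split; first by rewrite -!act_cat.
exists (act [:: (gx, true)] *m act (drop j r)) => g.
rewrite -(fox_mx_relation actP) // -splitE fox_mx_rot //.
by rewrite -!catA -rotE /rot fox_mx_rot // mulmxA cat_take_drop.
Qed.

(** Up to a power of x the longitude is W* W.  That it commutes with x, the
    relation of the peripheral torus, follows from W x = y W and x W* = W* y. *)
Lemma longitude_relation_chain : exists U, forall g,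
  (1%:M - act (Ws ++ W)) *m fox_mx act g [:: (gx, true)]
    + (act [:: (gx, true)] - 1%:M) *m fox_mx act g (Ws ++ W) =
    U *m fox_mx act g (bridge_relator k).
Proof.
have [relWs [U UE]] := swap_relation_chain; exists (U - act Ws) => g.
rewrite [RHS]mulmxBl -UE fox_mx_bridge_relator (fox_mx_cons actP _ _ Ws).
rewrite !(fox_mx_cat actP) act_cat !(mulmxBl, mulmxBr, mulmxDr, mul1mx, mulmxA).
rewrite relWs.
move: (_ *m _ *m fox_mx _ _ [:: _]) (_ *m _ *m fox_mx _ _ W) (_ *m fox_mx _ _ W)
  (_ *m fox_mx _ _ [:: (gy, true)]) (_ *m fox_mx _ _ Ws) => A1 A2 A3 A4 A5.
by apply/matrixP=> i j; rewrite !mxE; ring.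
Qed.

(** The matrix [T] inverts both generators, so that W* acts as T W^-1 T.  As the
    top row of W is (0, b), the bottom rows of W* W are those of - 1: the
    longitude of the knot has trace - 2 and not 2. *)
Lemma act_longitude_bottom :
  row_mx 0 1%:M *m act (Ws ++ W) = - row_mx 0 1%:M :> 'M_(d, d + d).
Proof.
pose T : 'M[int]_(d + d) := block_mx 1%:M 0 0 (- 1%:M).
have T_letter l : T *m act [:: l] = act [:: inv_letter l] *m T.
  case: l => [[] []]; rewrite /inv_letter /= ?(act_x, act_y, act_xV, act_yV)
    /T !mulmx_block;
  by rewrite !(mulmx0, mul0mx, mulmx1, mul1mx, addr0, add0r, mulmxN, mulNmx,
    opprK, oppr0).
have TT : T *m T = 1%:M.
  rewrite /T mulmx_block !(mulmx0, mul0mx, mulmx1, mul1mx, addr0, add0r).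
  by rewrite mulNmx mul1mx opprK -scalar_mx_block.
have TWs : T *m act W *m T *m act Ws = 1%:M.
  apply: mulmx1C; rewrite (act_intertwine actP T_letter) -mulmxA TT mulmx1.
  have -> : map inv_letter W = inv_word Ws.
    by rewrite swap_word_rev /inv_word map_rev revK.
  exact: act_invV.
pose Z : 'M[int]_(d, d + d) := row_mx (- (C *m b)) 0.
have ZT : Z *m T = Z.
  by rewrite /Z /T mul_row_block !(mulmx0, mul0mx, mulmx1, addr0).
have ZW : Z *m act W = row_mx 0 1%:M.
  rewrite /Z {2}act_bridge_word mul_row_block !(mulmx0, mul0mx, addr0).
  by rewrite mulNmx -mulmxA Cbb opprK.
have JT : row_mx 0 1%:M *m T = - row_mx 0 1%:M :> 'M_(d, d + d).
  by rewrite /T mul_row_block !(mulmx0, mul0mx, mul1mx, addr0, add0r) opp_row_mx oppr0.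
have JWs : row_mx 0 1%:M *m act Ws = - Z.
  have := congr1 (mulmx Z) TWs; rewrite mulmx1 !mulmxA ZT ZW JT mulNmx => <-.
  by rewrite opprK.
by rewrite act_cat mulmxA JWs mulNmx ZW.
Qed.

(** The last d rows of x - 1 vanish and those of 1 - (longitude) are twice those
    of 1, so that the relation of the torus says that the class of the loop x
    with coefficients in the last rows is killed by 2. *)
Lemma fox_pivot_dvd2 : exists G, G *m fox_pivot = 1%:M *+ 2.
Proof.
have [U UE] := longitude_relation_chain.
pose J : 'M[int]_(d, d + d) := row_mx 0 1%:M.
have JX : J *m (act [:: (gx, true)] - 1%:M) = 0.
  rewrite mulmxBr mulmx1 act_x mul_row_block.
  by rewrite !(mulmx0, mul0mx, mul1mx, addr0, add0r) subrr.
have JU g : J *m U *m fox_mx act g (bridge_relator k) =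
    (J *+ 2) *m fox_mx act g [:: (gx, true)].
  rewrite -mulmxA -UE mulmxDr !mulmxA JX mul0mx addr0.
  by rewrite mulmxBr mulmx1 act_longitude_bottom opprK mulr2n.
have := JU gx; have := JU gy; rewrite fox_mx_relator_x fox_mx_relator_y.
rewrite !fox_mx_letter //= mulmx0 mulmx1 -[J *m U]hsubmxK !mul_row_block.
set s1 := lsubmx _; set s2 := rsubmx _.
rewrite !(mulmx0, addr0, add0r) -row_mx0 => /eq_row_mx[s1E _].
rewrite /J mulr2n add_row_mx addr0 -mulr2n => /eq_row_mx[_ s2E].
exists s2; rewrite -s2E /fox_pivot mulmxBr addrC; congr (_ + _).
move: s1E; rewrite !mulmxN mulmx1 => /eqP; rewrite subr_eq0 eqr_oppLR => /eqP ->.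
by rewrite mulNmx !mulmxA.
Qed.

(** The pivot is twice a matrix [F] and divides 2, so that [F] is unimodular. *)
Lemma normr_det_fox_pivot : `|\det fox_pivot| = 2 ^+ d.
Proof.
have [F FE] := fox_pivot_even; have [G GE] := fox_pivot_dvd2.
have GF : G *m F = 1%:M.
  move: GE; rewrite FE mulr2n mulmxDr -mulr2n => /matrixP GF2; apply/matrixP=> i j.
  have := GF2 i j; rewrite !mulmxnE !mulr2n.
  by move: (_ i j) (_ i j) => x y; lia.
have F1 : `|\det F| = 1.
  apply/eqP; have /(congr1 (fun A => `|\det A|%N)) := GF.
  rewrite det_mulmx det1 abszM => /eqP; rewrite muln_eq1 => /andP[_].
  by rewrite -eqz_nat abszE.
by rewrite FE -scaler_nat detZ normrM F1 mulr1 normrX normr_nat.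
Qed.

Lemma normr_det_fox_sum :
  `|\det (fox_mx act gx (bridge_relator k) + fox_mx act gy (bridge_relator k))|
    = 2 ^+ d.
Proof.
rewrite -normr_det_fox_pivot fox_mx_relator_x fox_mx_relator_y add_block_mx.
rewrite !(addr0, add0r).
set M := block_mx _ _ _ _.
have M_lower : M *m block_mx 1%:M b 0 1%:M =
    block_mx (- 1%:M) 0 (- (C *m (1%:M - b *m C *m f))) fox_pivot.
  rewrite mulmx_block !(mulmx0, mul0mx, mulmx1, mul1mx, addr0, add0r) mulNmx.
  rewrite mul1mx addNr; congr (block_mx _ _ _ _).
  by rewrite mulNmx [LHS]addrC.
have := congr1 determinant M_lower.
rewrite det_mulmx det_ublock !det1 !mulr1 det_lblock => ->.
by rewrite -scaleN1r detZ det1 mulr1 normrM normrX normrN1 expr1n mul1r.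
Qed.

End TotalRepresentation.

(** * First homology with two generators *)

Section TwoGeneratorHomology.
Variables (R : comNzRingType) (m n : nat).
Variables (P Q : 'M[R]_(m, n)) (A B V : 'M[R]_n).
Hypothesis chain : row_mx P Q *m col_mx A B = 0.
Hypothesis AB_V : (A - B) *m V = 1%:M.

(** A cycle (u, v) is determined by the sum s = u + v, as u (A - B) = - s B; the
    module of cycles is thus free, with coordinates s. *)
Let S : 'M[R]_n := - (B *m V).
Let section : 'M[R]_(n, n + n) := row_mx S (1%:M - S).

Let section_cycle (u : 'rV[R]_n) : is_cycle (col_mx A B) (u *m section).
Proof.
apply/eqP; rewrite -mulmxA mul_row_col mulmxBl mul1mx addrCA -mulmxBr.
by rewrite mulNmx -mulmxA (mulmx1C AB_V) mulmx1 subrr mulmx0.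
Qed.

Let section_class (u : 'rV[R]_n) : homology (row_mx P Q) (col_mx A B) :=
  homology_class _ (Cycle (section_cycle u)).

Let section_class_linear : linear section_class.
Proof.
move=> r u v; rewrite /section_class.
have -> : Cycle (section_cycle (r *: u + v)) =
    r *: Cycle (section_cycle u) + Cycle (section_cycle v).
  by apply: val_inj; rewrite /= mulmxDl scalemxAl.
by rewrite homology_classD homology_classZ.
Qed.

HB.instance Definition _ := GRing.isLinear.Build R _ _ _ section_class
  section_class_linear.

Let cycle_section (u v : 'rV[R]_n) :
  is_cycle (col_mx A B) (row_mx u v) -> row_mx u v = (u + v) *m section.
Proof.
rewrite /is_cycle mul_row_col => /eqP /(canRL (addrK _)); rewrite sub0r => uA.
have uS : u = (u + v) *m S.
  rewrite mulmxN mulmxA -mulNmx mulmxDl opprD -[- (v *m B)]uA addrC.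
  by rewrite -mulmxBr -mulmxA AB_V mulmx1.
by rewrite mul_mx_row mulmxBr mulmx1 -uS addrAC subrr add0r.
Qed.

Lemma two_generator_presentation :
  is_presentation_matrix (homology (row_mx P Q) (col_mx A B)) (P + Q).
Proof.
exists section_class; split=> [h|v].
  have [z zh] : exists z, homology_class (row_mx P Q) z = h.
    by exists (repr h); apply: homology_class_repr.
  exists (lsubmx (val z) + rsubmx (val z)); rewrite -zh /section_class /=.
  congr homology_class; apply: val_inj; rewrite /= -cycle_section hsubmxK //.
  exact: cycleP.
have class0 : homology_class (row_mx P Q) (0 : Defs.cycle (col_mx A B)) = 0.
  by apply: (addrI (homology_class _ 0)); rewrite -homology_classD !addr0.
rewrite /= /section_class -class0; rewrite homology_classP subr0.
have bd (u : 'rV[R]_m) : u *m row_mx P Q = (u *m (P + Q)) *m section.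
  rewrite mul_mx_row mulmxDr; apply: cycle_section.
  by apply/eqP; rewrite -mul_mx_row -mulmxA chain mulmx0.
split=> [/asboolP[u /= uE]|[u ->]]; last first.
  by apply/asboolP; exists u; rewrite /= bd.
exists u; move: uE; rewrite bd => /(congr1 (fun x => x *m col_mx 1%:M 1%:M)).
by rewrite -!mulmxA mul_row_col !mulmx1 addrC subrK !mulmx1.
Qed.

End TwoGeneratorHomology.

(** * The twisted Alexander polynomial *)

Section TwistedAlexander.
Variables (k : two_bridge_knot) (d : nat) (C : 'M[int]_d).
Variable rho : knot_group k -> 'M[int]_(d + d).
Hypothesis rho_rep : is_representation rho.
Hypothesis rho_gen : forall g, rho (knot_gen k g) = riley_matrix C g.

Let act (u : word) : 'M[int]_(d + d) := rho (in_group k u).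
Let tact (u : word) : 'M[laurent]_(d + d) := twisted_action rho (in_group k u).

Lemma in_group_cat u v : in_group k (u ++ v) = (in_group k u * in_group k v)%g.
Proof. by symmetry; apply: group_mulE. Qed.

Lemma in_group_cancel l : in_group k [:: l; inv_letter l] = 1%g.
Proof. by apply/word_classP; apply: (weq_cancel _ [::] l [::]). Qed.

Lemma in_group_relator : in_group k (bridge_relator k) = 1%g.
Proof.
apply/word_classP.
by have := weq_relator (bridge_relator k) [::] [::]; rewrite /= cats0.
Qed.

Lemma abelianization1 : abelianization (1%g : knot_group k) = 0.
Proof. by rewrite [LHS](abelianization_word k [::]) /exponent_sum big_nil. Qed.

Lemma act_word_action : word_action act.
Proof.
have [rho1 rhoM] := rho_rep; split=> [|u v|l]; rewrite /act.
- exact: rho1.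
- by rewrite in_group_cat rhoM.
- by rewrite in_group_cancel.
Qed.

Lemma twisted_action1 : twisted_action rho 1%g = 1%:M.
Proof.
rewrite /twisted_action abelianization1 laurent_t0 scale1r.
by case: rho_rep => -> _; rewrite map_mx1.
Qed.

Lemma tact_word_action : word_action tact.
Proof.
split=> [|u v|l]; rewrite /tact; first exact: twisted_action1.
  rewrite in_group_cat /twisted_action abelianizationM laurent_tD.
  by case: rho_rep => _ ->; rewrite map_mxM -scalemxAl -scalemxAr scalerA.
by rewrite in_group_cancel twisted_action1.
Qed.

Lemma map_laurent_at1_int m n (A : 'M[int]_(m, n)) :
  map_mx laurent_at1 (map_mx intr A) = A.
Proof. by apply/matrixP=> i j; rewrite !mxE rmorph_int intz. Qed.

Lemma twisted_action_at1 g : map_mx laurent_at1 (twisted_action rho g) = rho g.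
Proof.
rewrite /twisted_action map_mxZ map_laurent_at1_int.
by rewrite [X in X *: _]laurent_at1_t scale1r.
Qed.

Lemma fox_action_at1 g u :
  map_mx laurent_at1 (fox_action rho g u) = fox_mx act g u.
Proof.
rewrite /fox_action raddf_sum; apply: eq_bigr => cv _.
by rewrite /= map_mxZ rmorph_int intz twisted_action_at1.
Qed.

Let M :=
  fox_action rho gx (bridge_relator k) + fox_action rho gy (bridge_relator k).

Let act_relator : act (bridge_relator k) = 1%:M.
Proof. by rewrite /act in_group_relator; case: rho_rep. Qed.

(** The two meridians differ by t times [swap_inv_mx], which is unimodular. *)
Lemma twisted_H1_presentation : is_presentation_matrix (twisted_H1 rho) M.
Proof.
pose b := ursubmx (act (bridge_word k)).
pose V : 'M[laurent]_(d + d) :=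
  laurent_t (-1) *: map_mx intr (block_mx 0 (b *m b) 1%:M 0).
apply: (@two_generator_presentation _ _ _ _ _ _ _ V).
  rewrite mul_row_col.
  have := fox_mx_fundamental tact_word_action (bridge_relator k).
  have -> : tact (bridge_relator k) = 1%:M.
    by rewrite /tact in_group_relator twisted_action1.
  by rewrite subrr.
rewrite opprB addrA subrK /twisted_action !abelianization_word.
rewrite /exponent_sum !big_seq1 -scalerBr -raddfB /=.
have -> : rho (in_group k [:: (gx, true)]) - rho (in_group k [:: (gy, true)]) =
    swap_inv_mx C by exact: (@act_x_sub_y _ C act rho_gen).
rewrite -scalemxAl -scalemxAr scalerA -laurent_tD subrr laurent_t0 scale1r.
rewrite -map_mxM /b.
by rewrite (swap_inv_mx_unit act_word_action rho_gen act_relator) map_mx1.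
Qed.

Lemma normr_twisted_alexander_at1 :
  `|laurent_at1 (twisted_alexander rho)| = 2 ^+ d.
Proof.
have orderM := square_presentation_order twisted_H1_presentation.
have orderD : is_order (twisted_H1 rho) (twisted_alexander rho).
  by apply: (@xgetPex _ 0 [set d | is_order (twisted_H1 rho) d]%classic);
     exists (\det M).
have [dM Md] := order_square_presentation twisted_H1_presentation orderD.
rewrite (normr_laurent_at1_associates dM Md) -det_map_mx map_mxD.
rewrite !fox_action_at1.
exact: normr_det_fox_sum act_word_action rho_gen act_relator.
Qed.

End TwistedAlexander.

Unset Implicit Arguments.

Theorem theorem6p1 (R : realType) (k : two_bridge_knot)
    (gamma : knot_group k -> 'M[R[i]]_2)
    (gamma_SL : is_SL_representation gamma)
    (gamma_parabolic : is_parabolic gamma)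
    (gamma_nonabelian : is_nonabelian gamma)
    (w : R[i]) (gamma_riley : riley_conjugate gamma w)
    (phi : {poly int}) (phi_factor : riley_factor k w phi)
    (gamma_phi : knot_group k -> 'M[int]_((size phi).-1 + (size phi).-1))
    (gamma_phi_total : is_total_representation gamma_phi) :
  `| laurent_at1 (twisted_alexander gamma_phi) | = 2 ^+ (size phi).-1.
Proof.
case: gamma_phi_total => gamma_phi_rep gamma_phi_gen.
exact: normr_twisted_alexander_at1 gamma_phi_rep gamma_phi_gen.
Qed.
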